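(* Let $d\ge 1$. There is a polynomial depending only on $d$, namely $p_d(t)=\sum_{k=0}^{d}(P_d^{-1})_{d,k}\,t^{d-k}$, whose coefficients are the entries of the last row of the inverse of the matrix $P_d$ (defined in the context), such that for every finite simplicial complex $X$ of dimension $d-1$ the following holds: as $n\to\infty$, the $d-1$ largest roots of $f^{X^{(n)}}(t)$ (counted with multiplicity) converge to $d-1$ values which are the roots of $p_d(t)$ (counted with multiplicity).
   Context: For a finite simplicial complex $X$ of dimension $d-1$, $f^X_i$ is the number of $i$-dimensional faces of $X$, with $f^X_{-1}=1$ (the empty face). The $f$-polynomial of $X$ is $f^X(t)=\sum_{j=0}^d f^X_{j-1}t^{d-j}$. $X^{(n)}$ denotes the $n$-th iterated barycentric subdivision of $X$. For $i,j\ge -1$, $\lambda_{i,j}$ is the number of $j$-dimensional faces in the interior of the first barycentric subdivision of the standard $i$-dimensional simplex (i.e. faces not contained in the boundary of the simplex), with the conventions $\lambda_{-1,-1}=1$, $\lambda_{i,-1}=0$ for $i\ge 0$, and $\lambda_{-1,j}=0$ for $j\geq 0$. $\Lambda_d$ is the $(d+1)\times(d+1)$ matrix $[\lambda_{i,j}]_{-1\le i,j\le d-1}$; it is lower triangular with diagonal entries $0!,1!,\dots,d!$. $P_d$ is a lower triangular matrix of eigenvectors diagonalizing it: $\Lambda_d=P_dD_dP_d^{-1}$ with $D_d=\mathrm{diag}(0!,1!,\dots,d!)$. For definiteness $P_d$ is normalized to have ones on the diagonal and, indexing its rows and columns by $0,\dots,d$, to have $(1,0)$-entry equal to $0$; this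 makes $P_d$ unique. The rows and columns of $P_d^{-1}$ are indexed by $0,\dots,d$. Roots are complex roots; ''the $d-1$ largest roots'' of the degree-$d$ polynomial $f^{X^{(n)}}(t)$ are the $d-1$ roots with largest real parts (the remaining root diverges to $-\infty$). *)

(* Defs.v *)
From mathcomp Require Import all_boot all_order all_algebra.

Set Implicit Arguments.
Unset Strict Implicit.
Unset Printing Implicit Defensive.

Import GRing.Theory.
Local Open Scope ring_scope.

(* Faces include the empty face. A point v of [vert] need not be a vertex of
   the complex: it is one exactly when [set v] is a face. *)
Record simpComplex := SimpComplex {
  vert : finType;
  faces : {set {set vert}};
  faces0 : set0 \in faces;
  faces_down : forall s t : {set vert}, s \subset t -> t \in faces -> s \in faces
}.

(* dim X + 1: a face with k vertices has dimension k - 1 *)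
Definition dimS (X : simpComplex) : nat := (\max_(s in faces X) #|s|)%N.

(* [fnum X j] is the number of faces of dimension j - 1 *)
Definition fnum (X : simpComplex) (j : nat) : nat :=
  #|[set s in faces X | #|s| == j]|.

Definition fpoly (X : simpComplex) : {poly rat} :=
  \sum_(j < (dimS X).+1) (fnum X j)%:R *: 'X^(dimS X - j).

(* The vertices of the barycentric subdivision are the nonempty faces of X, and
   its faces are the chains of nonempty faces. *)
Definition sd_faces (X : simpComplex) : {set {set {set vert X}}} :=
  [set c : {set {set vert X}} | (c \subset faces X :\ set0) &&
     [forall s in c, forall t in c, (s \subset t) || (t \subset s)]].

Lemma sd_faces0 (X : simpComplex) : set0 \in sd_faces X.
Proof.
rewrite inE sub0set; apply/forallP => s; apply/implyP.
by rewrite inE.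
Qed.

Lemma sd_faces_down (X : simpComplex) (c e : {set {set vert X}}) :
  c \subset e -> e \in sd_faces X -> c \in sd_faces X.
Proof.
move=> sce; rewrite !inE => /andP[se /forall_inP ch].
rewrite (subset_trans sce se); apply/forall_inP => s sc.
apply/forall_inP => t tc.
exact: (forall_inP (ch s (subsetP sce _ sc)) t (subsetP sce _ tc)).
Qed.

Definition sd (X : simpComplex) : simpComplex :=
  SimpComplex (@sd_faces0 X) (@sd_faces_down X).

Lemma simplex_faces0 (i : nat) : set0 \in [set: {set 'I_i.+1}].
Proof. by rewrite inE. Qed.

Lemma simplex_faces_down (i : nat) (s t : {set 'I_i.+1}) :
  s \subset t -> t \in [set: {set 'I_i.+1}] -> s \in [set: {set 'I_i.+1}].
Proof. by rewrite !inE. Qed.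

Definition simplex (i : nat) : simpComplex :=
  SimpComplex (simplex_faces0 i) (@simplex_faces_down i).

Lemma boundary_faces0 (i : nat) : set0 \in [set~ [set: 'I_i.+1]].
Proof.
rewrite !inE; apply/eqP => /setP /(_ ord0).
by rewrite !inE.
Qed.

Lemma boundary_faces_down (i : nat) (s t : {set 'I_i.+1}) :
  s \subset t -> t \in [set~ [set: 'I_i.+1]] -> s \in [set~ [set: 'I_i.+1]].
Proof.
move=> sst; rewrite !inE; apply: contraNneq => s1.
by rewrite -subTset -s1.
Qed.

Definition boundary (i : nat) : simpComplex :=
  SimpComplex (boundary_faces0 i) (@boundary_faces_down i).

(* [lambda a b] is lambda_{a-1,b-1}. *)
Definition lambda (a b : nat) : nat :=
  match a, b with
  | 0, 0 => 1
  | 0, _.+1 => 0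
  | _.+1, 0 => 0
  | i.+1, j.+1 => #|[set c in faces (sd (simplex i)) |
                      (#|c| == j.+1) && (c \notin faces (sd (boundary i)))]|
  end%N.

Definition Lambda (d : nat) : 'M[rat]_d.+1 :=
  \matrix_(i, j) (lambda i j)%:R.

Definition Dmx (d : nat) : 'M[rat]_d.+1 := diag_mx (\row_(k < d.+1) (k`!)%:R).

(* [is_trig_mx] means lower triangular. *)
Definition is_Pmx (d : nat) (P : 'M[rat]_d.+1) : Prop :=
  [/\ is_trig_mx P,
      forall i, P i i = 1,
      forall i j : 'I_d.+1, i = 1%N :> nat -> j = 0%N :> nat -> P i j = 0
    & Lambda d = P *m Dmx d *m invmx P].

Definition ppoly (d : nat) (P : 'M[rat]_d.+1) : {poly rat} :=
  \sum_(k < d.+1) invmx P ord_max k *: 'X^(d - k).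

From mathcomp Require Import complex.
From mathcomp Require Import boolp classical_sets reals topology normedtype.
From mathcomp Require Import sequences.
Import numFieldNormedType.Exports.

(* As a [numClosedFieldType], R[i] gets its topology from the complex modulus. *)
Definition Cplx (R : realType) : numClosedFieldType := R[i]%C.

(* [s] lists the complex roots of [p], each as often as its multiplicity. *)
Definition roots_of (R : realType) (p : {poly rat}) (s : seq (Cplx R)) : Prop :=
  let q : {poly Cplx R} := map_poly ratr p in
  q != 0 /\ q = lead_coef q *: \prod_(z <- s) ('X - z%:P).

Definition Re_ge (R : realType) : rel (Cplx R) :=
  fun z w => complex.Re w <= complex.Re z.

(* Main.v *)
Require Import Defs.
From mathcomp Require Import all_boot all_order all_algebra.
From mathcomp Require Import ring zify.
Import Order.TTheory GRing.Theory Num.Theory.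

Set Implicit Arguments.
Unset Strict Implicit.
Unset Printing Implicit Defensive.

(** The subdivision acts linearly on f-vectors. A face of the barycentric
    subdivision is a chain of nonempty faces of X, and its largest member
    t, which is the union of the chain, is the unique face whose interior
    contains it. The number of chains with j members and union t depends only
    on j and the size of t: it is the number of ordered partitions of t into j
    blocks, that is, lambda ([card_chains_onto], [lambdaE]). Hence
    f(sd X) = f(X) Lambda ([fnum_sd]), and with Lambda = P D P^-1 the f-vector
    of the n-th subdivision is a combination of the rows of P^-1 with
    coefficients a_k (k!)^n, where a_d is the number of facets of top dimension
    ([fvec_iter_sd]). For d >= 2 the eigenvalue d! dominates, so the f-vector,
    once divided by (d!)^n, converges to a positive multiple of the last row y
    of P^-1. That row is the left eigenvector of Lambda for d!, from which
    y_0 = 0 and y_j > 0 for j >= 1: the limit p_d has degree exactly d - 1,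
    while the f-polynomials are monic of degree d.

    One root therefore escapes, and it is the one with the least real part.
    Let F be the number of vertices of the n-th subdivision. The roots have sum
    -F, so the root l of least real part satisfies Re l <= - F / d
    ([min_root_bound]); thus l goes to infinity and F / l stays bounded.
    Writing the f-polynomial as (X - l) g and reading off the coefficients of g
    from the constant term up, this bound is enough to show that g converges
    to p_d made monic ([cvg_cofactor]). The other d - 1 roots are those of g,
    and the roots of monic polynomials of fixed degree depend continuously on
    the coefficients ([cvg_roots_monic]): a root of the limit is approached by
    some root of g, and both can be divided out.

    The matrix P exists and is unique because the equation Lambda P = P D,
    read row by row, is a recursion for the entries below the diagonal; its only
    vanishing pivot is 1! - 0! at the entry (1, 0), fixed by the normalization. *)

(** * Chains of nonempty sets and ordered partitions *)

Definition is_chain (T : finType) (c : {set {set T}}) : bool :=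
  [forall s in c, forall t in c, (s \subset t) || (t \subset s)].

(** For nonempty [t], the faces with [j] vertices in the interior of the
    subdivided simplex on [t]. Describing the top of the chain as its union makes
    the empty chain, with union [set0], fit without a separate case. *)
Definition chains_onto (T : finType) (t : {set T}) (j : nat) :=
  [set c : {set {set T}} | [&& is_chain c, set0 \notin c, #|c| == j & cover c == t]].

(** The number of ordered partitions of an [a]-set into [j] nonempty blocks, by
    choosing the union of all the blocks but the last. *)
Fixpoint ordered_partitions (j a : nat) : nat :=
  if j is j'.+1 then \sum_(i < a) 'C(a, i) * ordered_partitions j' i else (a == 0).

Lemma is_chainP (T : finType) (c : {set {set T}}) :
  reflect {in c &, forall s t : {set T}, (s \subset t) || (t \subset s)} (is_chain c).
Proof.
apply: (iffP forall_inP) => [H s t sc tc|H s sc].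
  by have /forall_inP := H s sc; apply.
by apply/forall_inP => t tc; apply: H.
Qed.

Lemma sub_chain (T : finType) (c e : {set {set T}}) :
  c \subset e -> is_chain e -> is_chain c.
Proof.
move=> /subsetP ce /is_chainP ch; apply/is_chainP => s t /ce sc /ce tc.
exact: ch.
Qed.

(** A largest member of a finite chain contains all the others. *)
Lemma cover_chain (T : finType) (c : {set {set T}}) :
  is_chain c -> c != set0 -> cover c \in c.
Proof.
move=> /is_chainP ch /set0Pn [s0 s0c].
case: (arg_maxnP (fun s : {set T} => #|s|) s0c) => s sc smax.
suff -> : cover c = s by [].
apply/eqP; rewrite eqEsubset; apply/andP; split; last exact: (bigcup_sup s).
apply/bigcupsP => t tc.
case/orP: (ch _ _ sc tc) => // st.
have /eqP -> // : s == t.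
by rewrite eqEcard st; apply: smax.
Qed.

Lemma sum_by_card (T : finType) (A : {set {set T}}) (g : nat -> nat) m :
  (forall s, s \in A -> #|s| < m) ->
  \sum_(s in A) g #|s| = \sum_(i < m) #|[set s in A | #|s| == i]| * g i.
Proof.
move=> Am.
case: m Am => [|m] Am.
  by rewrite big_ord0 big1 // => s /Am.
rewrite (partition_big (fun s : {set T} => inord #|s| : 'I_m.+1) xpredT) //=.
apply: eq_bigr => i _; rewrite -sum_nat_const.
rewrite [RHS](eq_bigl (fun s : {set T} => (s \in A) && (inord #|s| == i))).
  by apply: eq_bigr => s /andP[/Am sm /eqP <-]; rewrite inordK.
move=> s; rewrite inE; case sA: (s \in A) => //=.
by rewrite -val_eqE /= inordK // Am.
Qed.

Lemma sum_proper_subsets (T : finType) (t : {set T}) (g : nat -> nat) :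
  \sum_(s : {set T} | s \proper t) g #|s| = \sum_(i < #|t|) 'C(#|t|, i) * g i.
Proof.
have -> : \sum_(s : {set T} | s \proper t) g #|s| =
          \sum_(s in [set s : {set T} | s \proper t]) g #|s|.
  by apply: eq_bigl => s; rewrite inE.
rewrite (@sum_by_card _ _ _ #|t|); last by move=> s; rewrite inE => /proper_card.
apply: eq_bigr => i _; congr (_ * _).
rewrite -cards_draws; apply: eq_card => s; rewrite !inE.
case: (#|s| =P i) => [si|]; rewrite ?andbF // !andbT.
by rewrite properEcard si ltn_ord andbT.
Qed.

(** Deleting the top [t] of a chain leaves a chain onto a proper subset of [t], to
    which [t] can be put back: this is the recursion of [ordered_partitions]. *)
Lemma card_chains_onto (T : finType) j : forall t : {set T},
  #|chains_onto t j| = ordered_partitions j #|t|.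
Proof.
elim: j => [|j IH] t /=.
  rewrite cards_eq0; case: eqP => [-> | /eqP t0].
    apply: etrans (cards1 (set0 : {set {set T}})); apply: eq_card => c.
    rewrite !inE; apply/idP/eqP => [/and4P[_ _]|->].
      by rewrite cards_eq0 => /eqP.
    rewrite inE cards0 eqxx /cover big_set0 eqxx /= !andbT.
    by apply/is_chainP => s; rewrite inE.
  apply/eqP; rewrite cards_eq0 -subset0; apply/subsetP => c.
  rewrite !inE => /and4P[_ _]; rewrite cards_eq0 => /eqP ->.
  by rewrite /cover big_set0 eq_sym (negbTE t0).
rewrite -(sum_proper_subsets t (ordered_partitions j)).
(* Sort the chains by what remains of their union once the top is removed. *)
rewrite -sum1_card.
rewrite (partition_big (fun c => cover (c :\ t)) (fun s => s \proper t)) /=; last first.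
  move=> c; rewrite inE => /and4P[ch c0 /eqP cj /eqP ct].
  have cn0 : c != set0 by rewrite -card_gt0 cj.
  have tc : t \in c by rewrite -ct; exact: cover_chain.
  have t0 : t != set0 by apply: contraNneq c0 => <-.
  have st : cover (c :\ t) \subset t.
    rewrite -[in X in _ \subset X]ct; apply/bigcupsP => x.
    by rewrite in_setD1 => /andP[_ xc]; exact: (bigcup_sup x).
  case: (eqVneq (c :\ t) set0) => [-> | ne].
    by rewrite /cover big_set0 properEneq eq_sym t0 sub0set.
  have := cover_chain (sub_chain (subD1set c t) ch) ne.
  by rewrite in_setD1 properEneq st andbT => /andP[].
apply: eq_bigr => s st; rewrite sum1dep_card -IH.
have t_notin c : c \in chains_onto s j -> t \notin c.
  rewrite inE => /and4P[_ _ _ /eqP cs]; apply/negP => tc.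
  have := @bigcup_sup _ _ t (mem c) id tc; rewrite -/(cover c) cs => ts.
  by move: st; rewrite properE ts andbF.
rewrite -(@card_in_imset _ _ (fun c => t |: c) (mem (chains_onto s j))); last first.
  by move=> c e /t_notin tc /t_notin te E; rewrite -(setU1K tc) E setU1K.
apply: eq_card => c; apply/idP/imsetP.
  rewrite !inE => /andP[/and4P[ch c0 /eqP cj /eqP ct] cs].
  have cn0 : c != set0 by rewrite -card_gt0 cj.
  have tc : t \in c by rewrite -ct; exact: cover_chain.
  exists (c :\ t); last by rewrite setD1K.
  rewrite !inE cs (sub_chain (subD1set c t) ch) (negbTE c0) andbF /= andbT.
  by move: cj; rewrite (cardsD1 t) tc add1n => -[->].
case=> e es ->; have te := t_notin _ es.
rewrite !inE setU1K //; move: es; rewrite inE => /and4P[/is_chainP ech e0 /eqP ej /eqP es].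
rewrite cardsU1 te ej es !eqxx (negbTE e0) !andbT orbF /=.
have sst := proper_sub st.
have sub_t x : x \in e -> x \subset t.
  by move=> xe; apply: subset_trans sst; rewrite -es; exact: (bigcup_sup x).
apply/and3P; split.
- apply/is_chainP => x y; rewrite !inE => /orP[/eqP->|xe] /orP[/eqP->|ye].
  + by rewrite subxx.
  + by rewrite (sub_t y ye) orbT.
  + by rewrite (sub_t x xe).
  + exact: ech.
- by apply: contraTneq st => <-; rewrite properE sub0set andbF.
- by rewrite /cover big_setU1 //= -/(cover e) es; apply/eqP/setUidPl.
Qed.

Lemma ordered_partitions_small j a : a < j -> ordered_partitions j a = 0.
Proof.
elim: j a => [|j IH] a //= aj; apply: big1 => i _.
by rewrite IH ?muln0 //; apply: leq_trans (ltn_ord i) _.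
Qed.

Lemma ordered_partitions_diag a : ordered_partitions a a = a`!.
Proof.
elim: a => [|a IH] //=; rewrite big_ord_recr /= IH binSn factS big1 ?add0n // => i _.
by rewrite ordered_partitions_small ?muln0.
Qed.

Lemma ordered_partitions_gt0 j a : 0 < j -> j <= a -> 0 < ordered_partitions j a.
Proof.
elim: j a => [//|j IH] [//|a] _.
case: j IH => [_ _|j IH ja] /=; first by rewrite big_ord_recl.
rewrite big_ord_recr addn_gt0 binSn muln_gt0; apply/orP; right.
exact: (IH a isT ja).
Qed.

(** A chain lies in the subdivided boundary exactly when it omits the whole
    simplex, so the interior chains are those with union the whole simplex. *)
Lemma lambdaE a b : lambda a b = ordered_partitions b a.
Proof.
case: a b => [|i] [|j] //=; first by rewrite big_ord0.
rewrite -[RHS]/(ordered_partitions j.+1 i.+1) -[in RHS](card_ord i.+1) -cardsT -card_chains_onto.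
apply: eq_card => c.
rewrite !inE -/(is_chain c).
have ->: (c \subset [set: {set 'I_i.+1}] :\ set0) = (set0 \notin c).
  by rewrite subsetD1 subsetT.
have ->: (c \subset [set~ [set: 'I_i.+1]] :\ set0) = ([set: 'I_i.+1] \notin c) && (set0 \notin c).
  by rewrite subsetD1 subsetC sub1set inE.
case ch: (is_chain c); rewrite ?andbF //=.
case c0: (set0 \notin c) => //=; rewrite !andbT.
case: eqP => //= cj; rewrite negbK.
have cn0 : c != set0 by rewrite -card_gt0 cj.
apply/idP/eqP => [cT|<-]; last exact: cover_chain.
by apply/eqP; rewrite -subTset; exact: (bigcup_sup [set: 'I_i.+1]).
Qed.

Lemma card_face_lt (X : simpComplex) s : s \in faces X -> #|s| < (dimS X).+1.
Proof. by move=> sX; rewrite ltnS; exact: leq_bigmax_cond. Qed.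

(** * The f-vector of a barycentric subdivision *)

(** Each chain of faces is counted at its union, which is its largest member and
    hence a face of [X]. *)
Lemma fnum_sd (X : simpComplex) j :
  fnum (sd X) j = \sum_(i < (dimS X).+1) fnum X i * lambda i j.
Proof.
under eq_bigr do rewrite lambdaE.
rewrite -(sum_by_card (ordered_partitions j) (@card_face_lt X)).
under eq_bigr do rewrite -card_chains_onto.
have faceX (s t : {set vert X}) := @faces_down X s t.
rewrite /fnum -sum1_card.
rewrite (partition_big (@cover _) (mem (faces X))) /=; last first.
  move=> c; rewrite !inE => /andP[/andP[cX ch] _].
  have [->|cn0] := eqVneq c set0; first by rewrite /cover big_set0; exact: faces0.
  by have /(subsetP cX) := cover_chain ch cn0; rewrite !inE => /andP[].
apply: eq_bigr => t tX; rewrite sum1dep_card; apply: eq_card => c.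
rewrite !inE -/(is_chain c) subsetD1.
case ch: (is_chain c); rewrite ?andbF //= !andbT.
case: (cover c =P t) => ct; rewrite ?andbF //= !andbT.
suff -> : c \subset faces X by [].
by apply/subsetP => s sc; apply: faceX tX; rewrite -ct; exact: (bigcup_sup s).
Qed.

Lemma fnum_dimS_gt0 (X : simpComplex) : 0 < fnum X (dimS X).
Proof.
have [s sX sm] : {s | s \in faces X & dimS X = #|s|}.
  apply: eq_bigmax_cond; apply/card_gt0P; exists set0; exact: faces0.
by rewrite card_gt0; apply/set0Pn; exists s; rewrite inE sX sm /=.
Qed.

Lemma fnum_gt_dimS (X : simpComplex) j : dimS X < j -> fnum X j = 0.
Proof.
move=> Xj; apply: eq_card0 => s; rewrite !inE; apply/negP => /andP[sX /eqP sj].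
by move: (card_face_lt sX); rewrite sj ltnS leqNgt Xj.
Qed.

(** The chain count is triangular with nonzero diagonal, so the top nonzero entry
    of the f-vector stays in place. *)
Lemma dimS_sd (X : simpComplex) : dimS (sd X) = dimS X.
Proof.
apply/eqP; rewrite eqn_leq; apply/andP; split; rewrite leqNgt; apply/negP => lt.
  have := fnum_dimS_gt0 (sd X); rewrite fnum_sd big1 // => i _.
  by rewrite lambdaE ordered_partitions_small ?muln0 // (leq_trans (ltn_ord i)).
have := fnum_gt_dimS lt; rewrite fnum_sd big_ord_recr /= lambdaE ordered_partitions_diag => /eqP.
rewrite addn_eq0 muln_eq0 => /andP[_].
by rewrite eqn0Ngt fnum_dimS_gt0 /= eqn0Ngt fact_gt0.
Qed.

Lemma dimS_iter_sd (X : simpComplex) n : dimS (iter n sd X) = dimS X.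
Proof. by elim: n => //= n <-; rewrite dimS_sd. Qed.

Lemma fnum0 (X : simpComplex) : fnum X 0 = 1.
Proof.
rewrite /fnum -[RHS](cards1 (set0 : {set vert X})); apply: eq_card => s.
by rewrite !inE cards_eq0 andbC; case: eqP => // ->; rewrite faces0.
Qed.

(** * The eigenvectors of Lambda *)

Local Open Scope ring_scope.

Section StrongRecursion.
Variables (T : Type) (x0 : T) (G : (nat -> T) -> nat -> T).
Hypothesis G_local : forall u v i, (forall j, (j < i)%N -> u j = v j) -> G u i = G v i.

(** The value at [i] settles after [i.+1] rounds, whatever the initial
    sequence. *)
Definition strong_rec (i : nat) : T := iter i.+1 G (fun=> x0) i.

Lemma strong_recE i : strong_rec i = G strong_rec i.
Proof.
have stable m n k : (k < m)%N -> (k < n)%N ->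
    iter m G (fun=> x0) k = iter n G (fun=> x0) k.
  elim: m n k => // m IH [//|n] k; rewrite !ltnS /= => km kn.
  by apply: G_local => j jk; apply: IH; [apply: leq_trans km|apply: leq_trans kn].
by rewrite /strong_rec /=; apply: G_local => j ji; exact: (stable i j.+1).
Qed.
End StrongRecursion.

Lemma ltn_fact_gt1 i j : (i < j -> 1 < j -> i`! < j`!)%N.
Proof.
case: j => // j; rewrite ltnS => ij j0; rewrite factS.
apply: leq_ltn_trans (leq_fact ij) _.
by rewrite ltn_Pmull // fact_gt0.
Qed.

Section Eigenvectors.
Variable d : nat.
Implicit Types P : 'M[rat]_d.+1.

Lemma lambda_small a b : (a < b)%N -> lambda a b = 0%N.
Proof. by move=> ab; rewrite lambdaE ordered_partitions_small. Qed.

Lemma lambda_diag a : lambda a a = a`!.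
Proof. by rewrite lambdaE ordered_partitions_diag. Qed.

Lemma unipotent_unitmx P : is_trig_mx P -> (forall i, P i i = 1) -> P \in unitmx.
Proof.
by move=> trP P1; rewrite unitmxE det_trig // big1 ?unitr1.
Qed.

(** The diagonal term is set apart because the rest involves only the entries of
    [P] in earlier rows. *)
Lemma Lambda_mulE P i k :
  (Lambda d *m P) i k =
  i`!%:R * P i k + \sum_(j < d.+1 | (j < i)%N) (lambda i j)%:R * P j k.
Proof.
rewrite mxE (bigID (fun j : 'I_d.+1 => (j < i)%N)) /= addrC; congr (_ + _).
  rewrite (bigD1 i) /= ?ltnn // mxE lambda_diag big1 ?addr0 // => j.
  rewrite -leqNgt => /andP[ij /negP ji]; rewrite mxE lambda_small ?mul0r //.
  by rewrite ltn_neqAle ij andbT; apply: contra_notN ji => /eqP/val_inj ->.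
by apply: eq_bigr => j _; rewrite mxE.
Qed.

(** Read entrywise, [Lambda P = P D] is a recursion over the rows of [P]; this is
    the form in which both existence and uniqueness are proved. *)
Lemma is_PmxE P : is_Pmx P <->
  [/\ is_trig_mx P, forall i, P i i = 1,
      forall i j : 'I_d.+1, i = 1%N :> nat -> j = 0%N :> nat -> P i j = 0
    & forall i k : 'I_d.+1, (k`!%:R - i`!%:R) * P i k =
        \sum_(j < d.+1 | (j < i)%N) (lambda i j)%:R * P j k].
Proof.
split=> -[trP P1 P10 eqP]; have uP := unipotent_unitmx trP P1; split=> //.
  move=> i k; have := Lambda_mulE P i k.
  rewrite {1}eqP mulmxKV // mul_mx_diag !mxE => E.
  by rewrite mulrBl [k`!%:R * _]mulrC E addrAC subrr add0r.
apply: (canRL (mulmxK uP)); apply/matrixP => i k.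
by rewrite Lambda_mulE -eqP mul_mx_diag !mxE -mulrDl addrC subrK mulrC.
Qed.

(** The pivot [k! - i!] vanishes below the diagonal only at [i = 1], [k = 0], the
    entry prescribed by the normalization. *)
Lemma is_Pmx_inj P Q : is_Pmx P -> is_Pmx Q -> P = Q.
Proof.
move=> /is_PmxE[trP P1 P10 eqP] /is_PmxE[trQ Q1 Q10 eqQ].
apply/matrixP => i k; case: i.
elim/ltn_ind => i IH id; set i' := Ordinal id.
case: (ltngtP i k) => ik.
- by rewrite (is_trig_mxP trP) // (is_trig_mxP trQ).
- case: (leqP i 1) => i1.
    have i1' : i = 1%N by lia.
    have k0 : k = 0%N :> nat by lia.
    by rewrite P10 // Q10.
  have neq : (k`!%:R - i`!%:R : rat) != 0.
    by rewrite subr_eq0 eqr_nat neq_ltn ltn_fact_gt1.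
  apply: (mulfI neq); rewrite (eqP i' k) (eqQ i' k).
  by apply: eq_bigr => -[j jd] /= ji; rewrite IH.
- have -> : i' = k by apply: val_inj.
  by rewrite P1 Q1.
Qed.

(** Since [x / 0 = 0], the same formula gives the prescribed value [0] at the
    entry [(1, 0)]. *)
Definition eigcol_step (k : nat) (u : nat -> rat) (i : nat) : rat :=
  if (i < k)%N then 0 else if i == k then 1 else
  (\sum_(j < i) (lambda i j)%:R * u j) / (k`!%:R - i`!%:R).

Definition eigcol (k : nat) : nat -> rat := strong_rec 0 (eigcol_step k).

Lemma eigcolE k i : eigcol k i = eigcol_step k (eigcol k) i.
Proof.
apply: strong_recE => {}i u v uv; rewrite /eigcol_step.
case: ifP => // _; case: ifP => // _; congr (_ / _).
by apply: eq_bigr => j _; rewrite uv.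
Qed.

Lemma is_Pmx_eigcol : is_Pmx (\matrix_(i < d.+1, k < d.+1) eigcol k i).
Proof.
have col_small (k i : nat) : (i < k)%N -> eigcol k i = 0.
  by move=> ik; rewrite eigcolE /eigcol_step ik.
apply/is_PmxE; split.
- by apply/is_trig_mxP => i j ij; rewrite mxE col_small.
- by move=> i; rewrite mxE eigcolE /eigcol_step ltnn eqxx.
- by move=> i j i1 j0; rewrite mxE i1 j0 eigcolE /eigcol_step /= subrr invr0 mulr0.
move=> i k.
have -> : \sum_(j < d.+1 | (j < i)%N) (lambda i j)%:R *
            (\matrix_(i < d.+1, k < d.+1) eigcol k i) j k =
          \sum_(j < i) (lambda i j)%:R * eigcol k j.
  rewrite (big_ord_widen d.+1 (fun j => (lambda i j)%:R * eigcol k j)); last exact: ltnW.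
  by apply: eq_bigr => j _; rewrite mxE.
rewrite mxE; case: (ltngtP i k) => ik.
- rewrite col_small // mulr0 big1 // => j _.
  by rewrite col_small ?mulr0 // (ltn_trans (ltn_ord j)).
- case: (leqP i 1) => i1.
(* Zero pivot: the right-hand side is [lambda 1 0 = 0]. *)
    have i1' : i = 1%N :> nat by lia.
    have k0 : k = 0%N :> nat by lia.
    by rewrite i1' k0 subrr mul0r big_ord1 mul0r.
  have neq : (k`!%:R - i`!%:R : rat) != 0.
    by rewrite subr_eq0 eqr_nat neq_ltn ltn_fact_gt1.
  by rewrite eigcolE /eigcol_step ltnNge (ltnW ik) gtn_eqF //= mulrC divfK.
- rewrite ik subrr mul0r big1 // => j _.
  by rewrite col_small ?mulr0 // -ik.
Qed.

(** The last row of [P^-1] is a left eigenvector of [Lambda] for [d!]. *)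
Lemma invPmx_rowE P (j : 'I_d.+1) : is_Pmx P ->
  \sum_(i < d.+1) invmx P ord_max i * (lambda i j)%:R =
  d`!%:R * invmx P ord_max j.
Proof.
move=> [trP P1 _ eqP]; have uP := unipotent_unitmx trP P1.
have : invmx P *m Lambda d = Dmx d *m invmx P by rewrite eqP -!mulmxA mulKmx.
move/matrixP => /(_ ord_max j); rewrite mul_diag_mx !mxE => <-.
by apply: eq_bigr => i _; rewrite mxE.
Qed.

Lemma invPmx_row_max P : is_Pmx P -> invmx P ord_max ord_max = 1.
Proof.
move=> [trP P1 _ _]; have uP := unipotent_unitmx trP P1.
have /matrixP/(_ ord_max ord_max) := mulVmx uP; rewrite !mxE eqxx.
rewrite (bigD1 ord_max) //= P1 mulr1 big1 ?addr0 // => i im.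
by rewrite (is_trig_mxP trP) ?mulr0 // ltn_neqAle im /= -ltnS.
Qed.

(** Column 0 of [Lambda] is [1, 0, .., 0], so the eigenvector equation reads
    [y_0 = d! y_0]; for [d = 1] the normalization [P 1 0 = 0] is used instead.
    This makes the degree of p_d drop below [d]. *)
Lemma invPmx_row0 P : (0 < d)%N -> is_Pmx P -> invmx P ord_max ord0 = 0.
Proof.
move=> d0 PP; case: (leqP d 1) => d1.
  have [trP P1 P10 _] := PP; have uP := unipotent_unitmx trP P1.
  have /matrixP/(_ ord_max ord0) := mulVmx uP; rewrite !mxE.
  rewrite big_ord_recl P1 mulr1 big1 => [|i _]; last first.
    by rewrite P10 ?mulr0 //= /bump /=; have := ltn_ord i; lia.
  by rewrite addr0 => ->; rewrite -val_eqE /= gtn_eqF.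
have := invPmx_rowE ord0 PP; rewrite big_ord_recl mulr1 big1 ?addr0; last first.
  by move=> i _; rewrite /= mulr0.
move=> /eqP; rewrite -subr_eq0 -{1}[X in X - _]mul1r -mulrBl mulf_eq0 subr_eq0.
case/orP => [|/eqP //]; rewrite eq_sym pnatr_eq1; have := ltn_fact_gt1 d0 d1.
by rewrite fact0 => /gtn_eqF ->.
Qed.

(** Downward induction on [j] in
    [(d! - j!) y_j = sum_(i > j) y_i * lambda i j]; the term [i = d] is positive. *)
Lemma invPmx_row_gt0 P (j : 'I_d.+1) : (0 < j)%N -> is_Pmx P ->
  0 < invmx P ord_max j.
Proof.
move=> j0 PP; move: {2}(d - j)%N (leqnn (d - j)) => m.
elim: m j j0 => [|m IH] j j0 jm.
  have -> : j = ord_max by apply: val_inj => /=; have := ltn_ord j; lia.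
  by rewrite invPmx_row_max.
case: (eqVneq j ord_max) => [->|jn]; first by rewrite invPmx_row_max.
have jd : (j < d)%N by rewrite ltn_neqAle jn /= -ltnS.
have Y0 (i : 'I_d.+1) : (j < i)%N -> 0 < invmx P ord_max i.
  by move=> ji; apply: IH; have := ltn_ord i; lia.
have := invPmx_rowE j PP; rewrite (bigD1 j) //= lambda_diag => E.
have eqj : \sum_(i < d.+1 | i != j) invmx P ord_max i * (lambda i j)%:R =
           invmx P ord_max j * (d`!%:R - j`!%:R).
  by rewrite mulrBr [_ * d`!%:R]mulrC -E addrAC subrr add0r.
have f0 : 0 < (d`!%:R - j`!%:R : rat) by rewrite subr_gt0 ltr_nat ltn_fact_gt1 //; lia.
have : 0 < \sum_(i < d.+1 | i != j) invmx P ord_max i * (lambda i j)%:R.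
  rewrite (bigD1 ord_max) 1?eq_sym //= ltr_wpDr //.
    apply: sumr_ge0 => i /andP[ij _]; case: (ltnP i j) => ij'.
      by rewrite lambda_small // mulr0.
    by rewrite mulr_ge0 // ltW // Y0 // ltn_neqAle ij' andbT eq_sym.
  by rewrite invPmx_row_max // mul1r ltr0n lambdaE ordered_partitions_gt0 // ltnW.
by rewrite eqj pmulr_lgt0.
Qed.
End Eigenvectors.

(** * Iterated subdivisions *)

Definition fvec (X : simpComplex) (d : nat) : 'rV[rat]_d.+1 := \row_j (fnum X j)%:R.

Lemma fvec_sd (X : simpComplex) (d : nat) :
  dimS X = d -> fvec (sd X) d = fvec X d *m Lambda d.
Proof.
move=> Xd; apply/rowP => j; rewrite !mxE fnum_sd Xd natr_sum.
by apply: eq_bigr => i _; rewrite !mxE natrM.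
Qed.

Lemma fvec_iter_sd (X : simpComplex) (d n : nat) (P : 'M[rat]_d.+1) (j : 'I_d.+1) :
  dimS X = d -> is_Pmx P ->
  (fnum (iter n sd X) j)%:R =
  \sum_(k < d.+1) (fvec X d *m P) 0 k * k`!%:R ^+ n * invmx P k j :> rat.
Proof.
move=> Xd [trP P1 _ eqP]; have uP := unipotent_unitmx trP P1.
have E k : (fvec (iter n sd X) d *m P) 0 k = (fvec X d *m P) 0 k * k`!%:R ^+ n.
  elim: n => [|n IH]; first by rewrite mulr1.
  rewrite iterS fvec_sd ?dimS_iter_sd // eqP -!mulmxA mulVmx // mulmx1 mulmxA.
  by rewrite mul_mx_diag mxE IH [X in _ * X = _]mxE exprSr mulrA.
transitivity (fvec (iter n sd X) d 0 j); first by rewrite mxE.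
rewrite -[fvec _ _](mulmxK uP) mxE.
by apply: eq_bigr => k _; rewrite E.
Qed.

Lemma fvec_mul_Pmx_max (X : simpComplex) (d : nat) (P : 'M[rat]_d.+1) :
  is_Pmx P -> (fvec X d *m P) 0 ord_max = (fnum X d)%:R.
Proof.
move=> [trP P1 _ _]; rewrite mxE (bigD1 ord_max) //= P1 mulr1 mxE big1 ?addr0 // => i im.
by rewrite (is_trig_mxP trP) ?mulr0 // ltn_neqAle im /= -ltnS.
Qed.

Lemma fnum1_gt0 (X : simpComplex) : (0 < dimS X)%N -> (0 < fnum X 1)%N.
Proof.
move=> X0; have := fnum_dimS_gt0 X; rewrite card_gt0 => /set0Pn[s].
rewrite inE => /andP[sX /eqP sd]; move: X0; rewrite -sd => /card_gt0P[x xs].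
rewrite card_gt0; apply/set0Pn; exists [set x]; rewrite inE cards1 eqxx andbT.
by apply: faces_down sX; rewrite sub1set.
Qed.
(** * Roots of converging sequences of polynomials *)

From mathcomp Require Import complex.
From mathcomp Require Import boolp classical_sets reals topology normedtype.
From mathcomp Require Import sequences.
Import numFieldNormedType.Exports.
Local Open Scope classical_set_scope.

Section CoefficientwiseLimits.
Variable K : numFieldType.
Implicit Types (u v l F : nat -> K) (f g : nat -> {poly K}).

Lemma cvg0_bounded_mul u v (M : K) :
  (forall n, `|u n| <= M) -> v @ \oo --> (0 : K) -> (fun n => u n * v n) @ \oo --> (0 : K).
Proof.
move=> uM /cvgr0Pnorm_lt v0; apply/cvgr0Pnorm_lt => e e0.
have M0 : 0 <= M by apply: le_trans (uM 0%N).
have M1 : 0 < M + 1 by rewrite ltr_wpDl.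
have := v0 (e / (M + 1)) (divr_gt0 e0 M1); apply: filterS => n vn.
rewrite normrM; apply: (@le_lt_trans _ _ ((M + 1) * `|v n|)).
  by rewrite ler_wpM2r // (le_trans (uM n)) // lerDl.
by rewrite mulrC -ltr_pdivlMr.
Qed.

(** If [('X - l) * g], divided by [F], converges to [b] up to degree [m], where
    [F] tends to infinity and [l] grows at least as fast, then the monic cofactor
    [g] itself converges to [b]. With [u = F / l], comparing coefficients from the
    constant term up shows that [g_k + b_k u] tends to 0; in degree [m] this forces
    [u] to tend to -1. Working with this combination avoids knowing in advance
    that [u] converges: its boundedness is enough. *)
Lemma cvg_cofactor g l F (b : nat -> K) (m : nat) (M : K) :
  (forall n, l n != 0) -> (forall n, F n != 0) ->
  (forall n, `|F n / l n| <= M) -> (fun n => (F n)^-1) @ \oo --> (0 : K) ->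
  (forall n, (g n)`_m = 1) -> b m = 1 ->
  (forall k, (k <= m)%N ->
     (fun n => (('X - (l n)%:P) * g n)`_k / F n) @ \oo --> b k) ->
  forall k, (k <= m)%N -> (fun n => (g n)`_k) @ \oo --> b k.
Proof.
move=> l0 F0 uM Finv gm bm eb.
pose u n := F n / l n.
have linv : (fun n => (l n)^-1) @ \oo --> (0 : K).
  rewrite (_ : (fun n => _) = (fun n => u n * (F n)^-1)).
    exact: cvg0_bounded_mul uM Finv.
  by apply: funext => n; rewrite /u mulrAC divff ?F0 // mul1r.
have h0 k : (k <= m)%N -> (fun n => (g n)`_k + b k * u n) @ \oo --> (0 : K).
  elim: k => [|k IH] km.
    rewrite (_ : (fun n => _) = (fun n =>
        u n * (b 0%N - (('X - (l n)%:P) * g n)`_0 / F n))).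
      apply: cvg0_bounded_mul uM _; rewrite -[X in _ --> X](subrr (b 0%N)).
      by apply: cvgB; [exact: cvg_cst|exact: eb].
    apply: funext => n; rewrite /u mulrBl coefB coefXM coefCM /=.
    by field; rewrite l0 F0.
  rewrite (_ : (fun n => _) = (fun n =>
      ((g n)`_k + b k * u n) * (l n)^-1 - b k * (u n * (l n)^-1) +
      u n * (b k.+1 - (('X - (l n)%:P) * g n)`_k.+1 / F n))).
    rewrite [X in _ --> X](_ : 0 = 0 * 0 - b k * 0 + 0); last by rewrite !mulr0 subr0 addr0.
    apply: cvgD.
      apply: cvgB; first by apply: cvgM => //; exact: IH (ltnW km).
      by apply: cvgM; [exact: cvg_cst|exact: cvg0_bounded_mul uM linv].
    apply: cvg0_bounded_mul uM _; rewrite -[X in _ --> X](subrr (b k.+1)).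
    by apply: cvgB; [exact: cvg_cst|exact: eb].
  apply: funext => n; rewrite /u mulrBl coefB coefXM coefCM /=.
  by field; rewrite l0 F0.
have u1 : u @ \oo --> (-1 : K).
  rewrite (_ : u = (fun n => ((g n)`_m + b m * u n) - 1)).
    rewrite -[X in _ --> X]add0r; apply: cvgB; [exact: h0|exact: cvg_cst].
  by apply: funext => n; rewrite gm bm mul1r addrAC subrr add0r.
move=> k km.
rewrite (_ : (fun n => _) = (fun n => ((g n)`_k + b k * u n) - b k * u n)).
  rewrite [X in _ --> X](_ : b k = 0 - b k * -1); last by rewrite mulrN1 opprK add0r.
  by apply: cvgB; [exact: h0|apply: cvgM => //; exact: cvg_cst].
by apply: funext => n; rewrite addrK.
Qed.

Lemma cvg_sum_seq (I : Type) (r : seq I) (f : I -> nat -> K) (a : I -> K) :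
  (forall i, f i @ \oo --> a i) ->
  (fun n => \sum_(i <- r) f i n) @ \oo --> \sum_(i <- r) a i.
Proof.
move=> fa; elim: r => [|i r IH].
  by rewrite big_nil; under eq_fun do rewrite big_nil; exact: cvg_cst.
by rewrite big_cons; under eq_fun do rewrite big_cons; apply: cvgD.
Qed.

Lemma cvg_horner f (p : {poly K}) (m : nat) (x : K) :
  (forall n, (size (f n) <= m)%N) -> (size p <= m)%N ->
  (forall k, (fun n => (f n)`_k) @ \oo --> p`_k) ->
  (fun n => (f n).[x]) @ \oo --> p.[x].
Proof.
move=> fm pm fp; rewrite (horner_coef_wide _ pm).
under eq_fun do rewrite (horner_coef_wide _ (fm _)).
by apply: cvg_sum_seq => i; apply: cvgM; [exact: fp|exact: cvg_cst].
Qed.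

(** A monic polynomial at [x] is, in modulus, the product of the distances from
    [x] to its roots, so the least distance is at most its geometric mean. *)
Lemma near_root (s : seq K) (x : K) : s != [::] ->
  exists2 y, y \in s & `|x - y| ^+ size s <= `|(\prod_(z <- s) ('X - z%:P)).[x]|.
Proof.
move=> s0; set p := `|_|.
have [/hasP|/hasPn far] := boolP (has (fun y => `|x - y| ^+ size s <= p) s).
  by case=> y ys yp; exists y.
have : \prod_(y <- s | y \in s) p < \prod_(y <- s | y \in s) `|x - y| ^+ size s.
  apply: ltr_prod; first by case: (s) s0 => // y t _; rewrite /= inE eqxx.
  move=> y ys; rewrite normr_ge0 /=; have := far y ys.
  by rewrite real_leNgt ?negbK // ?realX ?normr_real.
rewrite -!big_seq big_const_seq count_predT iter_mulr_1 prodrXl.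
rewrite -normr_prod -(eq_bigr _ (fun z _ => hornerXsubC z x)) -horner_prod.
by rewrite ltxx.
Qed.

(** Synthetic division computes the quotient from the top coefficient down by
    continuous operations. *)
Lemma cvg_deflate f g (p q : {poly K}) (x : nat -> K) (a : K) (m : nat) :
  (forall n, (size (g n) <= m)%N) -> (size q <= m)%N ->
  (forall n, f n = ('X - (x n)%:P) * g n) -> p = ('X - a%:P) * q ->
  x @ \oo --> a -> (forall k, (fun n => (f n)`_k) @ \oo --> p`_k) ->
  forall k, (fun n => (g n)`_k) @ \oo --> q`_k.
Proof.
move=> gm qm fE pE xa fp.
(* [j] bounds the number of coefficients of degree at least [k], and so runs
   through them downwards. *)
suff H j : forall k, (m <= k + j)%N -> (fun n => (g n)`_k) @ \oo --> q`_k.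
  by move=> k; apply: (H m); exact: leq_addl.
elim: j => [|j IH] k mk.
  rewrite addn0 in mk; rewrite nth_default ?(leq_trans qm) //.
  under eq_fun do rewrite nth_default ?(leq_trans (gm _)) //.
  exact: cvg_cst.
rewrite (_ : (fun n => _) = (fun n => (f n)`_k.+1 + x n * (g n)`_k.+1)).
  rewrite (_ : q`_k = p`_k.+1 + a * q`_k.+1); last first.
    by rewrite pE mulrBl coefB coefXM coefCM /= subrK.
  apply: cvgD; first exact: fp.
  by apply: cvgM => //; apply: IH; rewrite addSnnS.
by apply: funext => n; rewrite fE mulrBl coefB coefXM coefCM /= subrK.
Qed.

(** Continuity of the roots. By [near_root] a root [a] of the limit is
    approached by roots [x n]; dividing both out lowers the degree, and
    multiplicities take care of themselves. *)
Lemma cvg_roots_monic (m : nat) (r : m.-tuple K) (w : nat -> seq K) :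
  (forall n, size (w n) = m) ->
  (forall k, (fun n => (\prod_(y <- w n) ('X - y%:P))`_k) @ \oo -->
             (\prod_(y <- r) ('X - y%:P))`_k) ->
  exists z : nat -> m.-tuple K,
    (forall n, perm_eq (z n) (w n)) /\
    forall i : 'I_m, (fun n => tnth (z n) i) @ \oo --> tnth r i.
Proof.
elim: m r w => [|m IH] r w sw wr.
  exists (fun=> [tuple]); split=> [n|[]//].
  by rewrite (size0nil (sw n)) perm_refl.
case/tupleP: r wr => a r wr.
have /choice[x xP] n : exists y, y \in w n /\
    `|a - y| ^+ m.+1 <= `|(\prod_(z <- w n) ('X - z%:P)).[a]|.
  have [|y yw yp] := @near_root (w n) a; first by rewrite -size_eq0 sw.
  by exists y; rewrite -(sw n).
have xa : x @ \oo --> a.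
  have fa : (fun n => (\prod_(y <- w n) ('X - y%:P)).[a]) @ \oo --> (0 : K).
    rewrite [X in _ --> X](_ : 0 = (\prod_(y <- [tuple of a :: r]) ('X - y%:P)).[a]).
      apply: (@cvg_horner _ _ m.+2) => // [n|].
        by rewrite size_prod_XsubC sw.
      by rewrite size_prod_XsubC size_tuple.
    by apply/esym/rootP; rewrite root_prod_XsubC inE eqxx.
  apply/cvgrPdist_lt => e e0; move/cvgr0Pnorm_lt: fa => /(_ _ (exprn_gt0 m.+1 e0)).
  apply: filterS => n fn; have [_ /le_lt_trans/(_ fn)] := xP n.
  by rewrite ltr_pXn2r ?nnegrE ?normr_ge0 ?(ltW e0).
have wE n : perm_eq (w n) (x n :: rem (x n) (w n)) by apply: perm_to_rem; case: (xP n).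
have sw' n : size (rem (x n) (w n)) = m by rewrite size_rem ?sw //; case: (xP n).
have [|z [zw zr]] := IH r (fun n => rem (x n) (w n)) sw'.
  apply: (@cvg_deflate (fun n => \prod_(y <- w n) ('X - y%:P)) _
    (\prod_(y <- [tuple of a :: r]) ('X - y%:P)) _ x a m.+1) => //.
  - by move=> n; rewrite size_prod_XsubC sw'.
  - by rewrite size_prod_XsubC size_tuple.
  - by move=> n; rewrite (perm_big _ (wE n)) big_cons.
  - by rewrite big_cons.
exists (fun n => [tuple of x n :: z n]); split=> [n|i].
  by rewrite perm_sym (perm_trans (wE n)) //= perm_cons perm_sym.
case: (unliftP ord0 i) => [j|] ->.
  by rewrite tnthS; under eq_fun do rewrite tnthS; exact: zr.
by rewrite tnth0; under eq_fun do rewrite tnth0.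
Qed.
End CoefficientwiseLimits.

(** * Growth of the f-vectors *)

Lemma sum_rev_poly (K : nzRingType) (d : nat) (c : nat -> K) :
  \sum_(j < d.+1) c j *: 'X^(d - j) = \poly_(i < d.+1) c (d - i)%N.
Proof.
rewrite poly_def (reindex_inj rev_ord_inj) /=; apply: eq_bigr => i _.
by rewrite subSS subKn // -ltnS.
Qed.

Section Asymptotics.
Variable R : realType.
Let C := Cplx R.

Lemma cvg_ratr_expr (x : rat) : 0 <= x < 1 ->
  (fun n => (ratr x : C) ^+ n) @ \oo --> (0 : C).
Proof.
move=> /andP[x0 x1]; apply/cvgr0Pnorm_lt => e; rewrite ltcE => /andP[/eqP /= e0 e1].
have xR : `|ratr x : R| < 1 by rewrite ger0_norm ?ler0q // -(rmorph1 (@ratr R)) ltr_rat.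
have /cvgr0Pnorm_lt/(_ _ e1) := cvg_expr xR.
apply: filterS => n; rewrite !ger0_norm ?exprn_ge0 ?ler0q // => xe.
have -> : (ratr x : C) = (ratr x)%:C%C by rewrite fmorph_rat.
by rewrite -rmorphXn /= ltcE /= e0 eqxx.
Qed.

Variables (d : nat) (P : 'M[rat]_d.+1) (X : simpComplex).
Hypotheses (d_ge2 : (2 <= d)%N) (PP : is_Pmx P) (Xd : dimS X = d).
Let y (j : nat) : rat := invmx P ord_max (inord j).
Let fX (n j : nat) : nat := fnum (iter n sd X) j.

Lemma y_gt0 j : (0 < j)%N -> (j <= d)%N -> 0 < y j.
Proof. by move=> j0 jd; apply: invPmx_row_gt0 => //; rewrite inordK. Qed.

(** In the expansion along the eigenvalues, divided by [(d!)^n], every term but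
    that of the top eigenvalue dies out. *)
Lemma cvg_fnum_scaled j : (j <= d)%N ->
  (fun n => (fX n j)%:R * ratr (d`!%:R^-1) ^+ n) @ \oo -->
  ((fnum X d)%:R * ratr (y j) : C).
Proof.
move=> jd; set a := fvec X d *m P.
(* [lim k] is the limit of the contribution of the eigenvalue [k!]. *)
pose lim (k : 'I_d.+1) : C := if k == ord_max then ratr (a 0 k * y j) else 0.
have -> : (fnum X d)%:R * ratr (y j) = \sum_k lim k.
  rewrite (bigD1 ord_max) //= big1 ?addr0 /lim ?eqxx.
    by rewrite fvec_mul_Pmx_max // rmorphM /= ratr_nat.
  by move=> k /negbTE ->.
rewrite (_ : (fun n => _) = (fun n => \sum_(k < d.+1)
    ratr (a 0 k * invmx P k (inord j)) * (ratr (k`!%:R / d`!%:R) : C) ^+ n)).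
  apply: cvg_sum_seq => k; rewrite /lim.
  have d0 : 0 < (d`!%:R : rat) by rewrite ltr0n fact_gt0.
  case: eqP => [->|/eqP kd].
    rewrite divff ?lt0r_neq0 // rmorph1; under eq_fun do rewrite expr1n mulr1.
    exact: cvg_cst.
  rewrite -[X in _ --> X](mulr0 (ratr (a 0 k * invmx P k (inord j)))).
  apply: cvgM; first exact: cvg_cst.
  apply: cvg_ratr_expr; rewrite divr_ge0 // ltr_pdivrMr // mul1r ltr_nat.
  by apply: ltn_fact_gt1 => //; rewrite ltn_neqAle kd -ltnS ltn_ord.
apply: funext => n; have := fvec_iter_sd n (inord j) Xd PP; rewrite inordK // => E.
rewrite /fX -(ratr_nat C) E rmorph_sum /= mulr_suml.
apply: eq_bigr => k _; rewrite !rmorphM !rmorphXn /= [(_ * ratr d`!%:R^-1) ^+ n]exprMn -/a; ring.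
Qed.

Lemma fX1_gt0 n : (0 < fX n 1)%N.
Proof. by apply: fnum1_gt0; rewrite dimS_iter_sd Xd ltnW. Qed.

Lemma cvg_scale : (fun n => (ratr (d`!%:R^-1) : C) ^+ n) @ \oo --> (0 : C).
Proof.
apply: cvg_ratr_expr; rewrite invr_ge0 ler0n invf_lt1 ?ltr0n ?fact_gt0 //.
by rewrite ltr1n -fact0 ltn_fact_gt1 // ltnW.
Qed.

Lemma scale_neq0 n : (ratr (d`!%:R^-1) : C) ^+ n != 0.
Proof. by rewrite expf_neq0 // fmorph_eq0 invr_eq0 pnatr_eq0 -lt0n fact_gt0. Qed.

Lemma cvg_scaled_fnum1V :
  (fun n => ((fX n 1)%:R * ratr (d`!%:R^-1) ^+ n)^-1) @ \oo -->
  (((fnum X d)%:R * ratr (y 1))^-1 : C).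
Proof.
apply: cvgV; last by apply: cvg_fnum_scaled; exact: ltnW.
rewrite mulf_neq0 ?fmorph_eq0 ?lt0r_neq0 ?y_gt0 //; last exact: ltnW.
by rewrite ltr0n -Xd fnum_dimS_gt0.
Qed.

(** Dividing by the number of vertices instead of [(d!)^n] removes the
    dependence of the limit on [X]. *)
Lemma cvg_fnum_ratio j : (j <= d)%N ->
  (fun n => (fX n j)%:R / (fX n 1)%:R) @ \oo --> (ratr (y j / y 1) : C).
Proof.
move=> jd; have c0 : ((fnum X d)%:R : C) != 0 by rewrite pnatr_eq0 -lt0n -Xd fnum_dimS_gt0.
rewrite [X in _ --> X](_ : _ = ((fnum X d)%:R * ratr (y j)) * ((fnum X d)%:R * ratr (y 1))^-1).
  rewrite (_ : (fun n => _) = (fun n => ((fX n j)%:R * ratr (d`!%:R^-1) ^+ n) *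
      ((fX n 1)%:R * ratr (d`!%:R^-1) ^+ n)^-1)).
    by apply: cvgM; [exact: cvg_fnum_scaled|exact: cvg_scaled_fnum1V].
  by apply: funext => n; rewrite -mulf_div divff ?mulr1 // scale_neq0.
by rewrite -mulf_div divff // mul1r fmorph_div.
Qed.

Lemma cvg_fnum1V : (fun n => (fX n 1)%:R^-1) @ \oo --> (0 : C).
Proof.
rewrite (_ : (fun n => _) = (fun n => ratr (d`!%:R^-1) ^+ n *
    ((fX n 1)%:R * ratr (d`!%:R^-1) ^+ n)^-1)).
  rewrite -[X in _ --> X](mul0r (((fnum X d)%:R * ratr (y 1))^-1)).
  by apply: cvgM; [exact: cvg_scale|exact: cvg_scaled_fnum1V].
by apply: funext => n; rewrite invfM mulrCA divff ?mulr1 // scale_neq0.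
Qed.

End Asymptotics.

(** * The escaping root *)

Lemma roots_of_size (R : realType) (p : {poly rat}) (s : seq (Cplx R)) :
  roots_of p s -> size p = (size s).+1.
Proof.
case; rewrite map_poly_eq0 -(size_map_poly (@ratr (Cplx R)) p) => p0 ->.
by rewrite size_scale ?size_prod_XsubC // lead_coef_map fmorph_eq0 lead_coef_eq0.
Qed.

Lemma roots_of_coef (R : realType) (p : {poly rat}) (s : seq (Cplx R)) k :
  roots_of p s -> (\prod_(z <- s) ('X - z%:P))`_k = ratr (p`_k / lead_coef p).
Proof.
case; rewrite map_poly_eq0 => p0 pE.
have : (map_poly ratr p : {poly Cplx R})`_k = ratr p`_k by rewrite coef_map.
rewrite pE coefZ lead_coef_map fmorph_div /= => <-.
by rewrite mulrAC divff ?mul1r // fmorph_eq0 lead_coef_eq0.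
Qed.

Lemma roots_of_exist (R : realType) (p : {poly rat}) :
  p != 0 -> exists s : seq (Cplx R), roots_of p s.
Proof.
move=> p0; have [s sE] := closed_field_poly_normal (map_poly ratr p : {poly Cplx R}).
by exists s; split; rewrite ?map_poly_eq0.
Qed.

(** The root of least real part lies below the average of the real parts, which
    Vieta's formula gives as [- N / m.+1]. *)
Lemma min_root_bound (R : realType) (s : seq (Cplx R)) (N m : nat) :
  size s = m.+1 -> sorted (@Re_ge R) s -> (0 < N)%N ->
  (\prod_(x <- s) ('X - x%:P))`_m = N%:R ->
  nth 0 s m != 0 /\ `|N%:R / nth 0 s m| <= m.+1%:R.
Proof.
move=> sm ss N0 coefm; set z := nth 0 s m.
have ReD : {morph (@complex.Re R) : x y / x + y} by case=> [a b] [c e].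
have sumE : \sum_(x <- s) x = - N%:R.
  by apply: oppr_inj; rewrite opprK -coefm -[m]/(m.+1.-1) -sm coefPn_prod_XsubC ?sm.
have zmin x : x \in s -> complex.Re z <= complex.Re x.
  move=> xs; rewrite -(nth_index 0 xs).
  have tr : transitive (@Re_ge R) by move=> a b c ab bc; exact: le_trans bc ab.
  apply: (sorted_leq_nth tr _ 0 ss); rewrite ?inE ?index_mem ?sm //.
    by move=> a; exact: lexx.
  by rewrite -ltnS -sm index_mem.
have ReN : N%:R <= m.+1%:R * - complex.Re z.
  have -> : N%:R = - \sum_(x <- s) complex.Re x.
    rewrite -(big_morph _ ReD (erefl : complex.Re (0 : Cplx R) = 0)) sumE.
    by rewrite -(rmorph_nat (real_complex R)) -rmorphN /= opprK.
  rewrite mulrN lerN2 -sm mulr_natl -[X in X <= _]addr0 -iter_addr -count_predT -big_const_seq.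
  by rewrite big_seq [leRHS]big_seq; apply: ler_sum => x /zmin.
have Rez : complex.Re z < 0.
  rewrite -oppr_gt0 -(pmulr_rgt0 _ (ltr0Sn R m)).
  by apply: lt_le_trans ReN; rewrite ltr0n.
have z0 : z != 0 by apply: contraTneq Rez => ->; rewrite ltxx.
split=> //; rewrite normf_div normr_nat ler_pdivrMr ?normr_gt0 //.
apply: (@le_trans _ _ (m.+1%:R * (`|complex.Re z|)%:C%C)); last first.
  by rewrite ler_wpM2l ?ler0n // normc_ge_Re.
rewrite -!(rmorph_nat (real_complex R)) -rmorphM lecR ltr0_norm //.
Qed.

Lemma fpolyE (X : simpComplex) :
  fpoly X = \poly_(i < (dimS X).+1) (fnum X (dimS X - i))%:R.
Proof. exact: (sum_rev_poly _ (fun j => (fnum X j)%:R)). Qed.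

Lemma ppolyE (d : nat) (P : 'M[rat]_d.+1) :
  ppoly P = \poly_(i < d.+1) invmx P ord_max (inord (d - i)).
Proof.
rewrite -(sum_rev_poly d (fun j => invmx P ord_max (inord j))).
by apply: eq_bigr => k _; rewrite inord_val.
Qed.

Lemma size_ppoly (d : nat) (P : 'M[rat]_d.+1) :
  (0 < d)%N -> is_Pmx P -> size (ppoly P) = d.
Proof.
move=> d0 PP; rewrite ppolyE; have y0 := invPmx_row0 d0 PP.
have := @size_poly_eq _ d (fun i => invmx P ord_max (inord (d - i))).
rewrite !poly_def big_ord_recr /= subnn [X in _ + X *: _](_ : _ = 0); last first.
  rewrite -[RHS]y0; congr (invmx P _ _); apply: val_inj; rewrite /= inordK //.
by rewrite scale0r addr0; apply; rewrite lt0r_neq0 // invPmx_row_gt0 // inordK //; lia.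
Qed.

(** * Convergence of the roots *)

Theorem theorem1 (R : realType) (d : nat) (d_ge1 : (1 <= d)%N) :
  exists P : 'M[rat]_d.+1, unique (@is_Pmx d) P /\
  exists r : (d.-1).-tuple (Cplx R), roots_of (ppoly P) r /\
  forall X : simpComplex, dimS X = d ->
  forall w : nat -> seq (Cplx R),
    (forall n, roots_of (fpoly (iter n sd X)) (w n)
               /\ sorted (@Re_ge R) (w n)) ->
  exists z : nat -> (d.-1).-tuple (Cplx R),
    (forall n, perm_eq (z n) (take d.-1 (w n))) /\
    (forall i : 'I_d.-1, (fun n => tnth (z n) i) @ \oo --> tnth r i).
Proof.
set P : 'M[rat]_d.+1 := \matrix_(i, k) eigcol k i.
have PP : is_Pmx P := is_Pmx_eigcol d.
exists P; split; first by split=> // Q; exact: is_Pmx_inj.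
have szp := size_ppoly d_ge1 PP.
have [r rP] : exists r : seq (Cplx R), roots_of (ppoly P) r.
  by apply: roots_of_exist; rewrite -size_poly_gt0 szp.
have sr : size r == d.-1 by rewrite -szp (roots_of_size rP).
exists (Tuple sr); split=> // X Xd w wP.
have szw n : size (w n) = d.
  have := roots_of_size (wP n).1; rewrite fpolyE size_poly_eq; last first.
    by rewrite subnn fnum0 oner_neq0.
  by rewrite dimS_iter_sd Xd => -[].
have sztake n : size (take d.-1 (w n)) = d.-1 by rewrite size_takel ?szw ?leq_pred.
have [d_le1|d_ge2] := leqP d 1.
  have d1 : d.-1 = 0%N by lia.
  exists (fun n => Tuple (introT eqP (sztake n))); split=> [n|]; first exact: perm_refl.
  by case=> i id; exfalso; lia.
apply: cvg_roots_monic => // k.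
have dd : (d - d.-1)%N = 1%N by lia.
(* [w n] is sorted, so its last entry [l n] is the root that escapes. *)
pose g n : {poly Cplx R} := \prod_(z <- take d.-1 (w n)) ('X - z%:P).
pose l n := nth 0 (w n) d.-1.
have fE n : \prod_(z <- w n) ('X - z%:P) = ('X - (l n)%:P) * g n.
  rewrite -{1}[w n](@take_size) szw -{1}(prednK d_ge1) (take_nth 0) ?szw ?prednK //.
  by rewrite -cats1 big_cat big_seq1 mulrC.
have coefE n j : (j <= d)%N ->
    (('X - (l n)%:P) * g n)`_j = (fnum (iter n sd X) (d - j))%:R.
  move=> jd; rewrite -fE (roots_of_coef _ (wP n).1) fpolyE lead_coef_poly ?subnn ?fnum0 ?oner_neq0 //.
  by rewrite coef_poly dimS_iter_sd Xd ltnS jd divr1 ratr_nat.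
have fnum1 n := fX1_gt0 d_ge2 Xd n.
have lP n := min_root_bound (etrans (szw n) (esym (prednK d_ge1))) (wP n).2 (fnum1 n).
have {}lP n : l n != 0 /\ `|(fnum (iter n sd X) 1)%:R / l n| <= d.-1.+1%:R.
  by apply: lP; rewrite fE coefE ?leq_pred // dd.
have [kd|dk] := leqP k d.-1; last first.
  rewrite nth_default ?size_prod_XsubC ?(eqP sr) //.
  under eq_fun do rewrite nth_default ?size_prod_XsubC ?sztake //.
  exact: cvg_cst.
rewrite (roots_of_coef _ rP).
have rE j : (j <= d.-1)%N -> (ppoly P)`_j = invmx P ord_max (inord (d - j)).
  by move=> jd; rewrite ppolyE coef_poly ltnS (leq_trans jd (leq_pred _)).
have leadE : lead_coef (ppoly P) = invmx P ord_max (inord 1).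
  by rewrite lead_coefE szp rE // dd.
rewrite leadE.
apply: (@cvg_cofactor _ g l (fun n => (fnum (iter n sd X) 1)%:R)
  (fun k => ratr ((ppoly P)`_k / invmx P ord_max (inord 1))) d.-1 d.-1.+1%:R) => //.
- by move=> n; case: (lP n).
- by move=> n; rewrite pnatr_eq0 -lt0n.
- by move=> n; case: (lP n).
- exact: cvg_fnum1V PP Xd.
- move=> n; have := monic_prod_XsubC (take d.-1 (w n)) xpredT id.
  by rewrite monicE lead_coefE size_prod_XsubC sztake => /eqP.
- rewrite rE // dd divff ?rmorph1 // lt0r_neq0 // invPmx_row_gt0 //.
  by rewrite inordK // ltnS ltnW.
move=> j jd; rewrite rE //.
under eq_fun do rewrite coefE ?(leq_trans jd (leq_pred _)) //.
by apply: cvg_fnum_ratio => //; exact: leq_subr.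
Qed.
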